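(* Let $(\mathbf{R},r)$ be a ranked category, $\mathbf{C}$ a category and $F:\mathbf{C}\to\mathbf{R}$ a functor. Then the function $r\circ\mathrm{im}\circ F:\mathrm{Morph}(\mathbf{C})\to\mathbb{Z}$ is a categorical persistence function.
   Context: Ranked category: a regular category $\mathbf{R}$ with a rank function, i.e. a lower-bounded $r:\mathrm{Obj}(\mathbf{R})\to\mathbb{Z}$ such that: (1) $r(A)\le r(B)$ for any monomorphism $A\hookrightarrow B$; (2) $r(B)\ge r(D)$ for any regular epimorphism $B\twoheadrightarrow D$; (3) for any pullback square with monomorphisms $A\hookrightarrow B$, $C\hookrightarrow D$ and regular epimorphisms $A\twoheadrightarrow C$, $B\twoheadrightarrow D$, $r(B)-r(A)\ge r(D)-r(C)$. In a regular category every morphism $\phi:X\to Y$ factors as a regular epimorphism $X\twoheadrightarrow Z$ followed by a monomorphism $Z\hookrightarrow Y$; $Z=\mathrm{im}(\phi)$ is its image, and $\mathrm{im}:\mathrm{Morph}(\mathbf{R})\to\mathrm{Obj}(\mathbf{R})$ is the map associating to a morphism its image. Categorical persistence function on a category $\mathbf{C}$: a lower-bounded function $p:\mathrm{Morph}(\mathbf{C})\to\mathbb{Z}$ such that for all composable morphisms $u_1\to u_2\to v_1\to v_2$ (where $p(u_i\to v_j)$ is the value at the corresponding composite): (1) $p(u_1\to v_1)\le p(u_2\to v_1)$ and $p(u_2\to v_2)\le p(u_2\to v_1)$; (2) $p(u_2\to v_1)-p(u_1\to v_1)\ge p(u_2\to v_2)-p(u_1\to v_2)$. *)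

(* Defs.v *)
From Stdlib Require Import ZArith List.

Set Implicit Arguments.
Unset Strict Implicit.
Unset Printing Implicit Defensive.

Record category : Type := Category {
  obj :> Type;
  hom : obj -> obj -> Type;
  idm : forall X : obj, hom X X;
  comp : forall X Y Z : obj, hom Y Z -> hom X Y -> hom X Z;
  comp_id_l : forall (X Y : obj) (f : hom X Y), comp (idm Y) f = f;
  comp_id_r : forall (X Y : obj) (f : hom X Y), comp f (idm X) = f;
  comp_assoc : forall (X Y Z W : obj) (h : hom Z W) (g : hom Y Z) (f : hom X Y),
    comp h (comp g f) = comp (comp h g) f
}.

Arguments hom {c} X Y.
Arguments idm {c} X.

Declare Scope cat_scope.
Notation "g ∘ f" := (comp g f) (at level 40, left associativity) : cat_scope.
Open Scope cat_scope.

Record functor (C D : category) : Type := Functor {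
  fobj :> C -> D;
  fmap : forall X Y : C, hom X Y -> hom (fobj X) (fobj Y);
  fmap_id : forall X : C, fmap (idm X) = idm (fobj X);
  fmap_comp : forall (X Y Z : C) (g : hom Y Z) (f : hom X Y),
    fmap (g ∘ f) = fmap g ∘ fmap f
}.

Arguments fmap {C D} _ {X Y} _.

Definition mono (C : category) (X Y : C) (f : hom X Y) : Prop :=
  forall (T : C) (a b : hom T X), f ∘ a = f ∘ b -> a = b.

Definition is_coequalizer (C : category) (A X Q : C)
    (f g : hom A X) (e : hom X Q) : Prop :=
  e ∘ f = e ∘ g /\
  forall (T : C) (h : hom X T), h ∘ f = h ∘ g -> exists! k : hom Q T, k ∘ e = h.

Definition regular_epi (C : category) (X Q : C) (e : hom X Q) : Prop :=
  exists (A : C) (f g : hom A X), is_coequalizer f g e.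

(* The square    P --p2--> Y
                 |         |
                 p1        g
                 v         v
                 X ---f--> Z     *)
Definition is_pullback (C : category) (X Y Z P : C)
    (f : hom X Z) (g : hom Y Z) (p1 : hom P X) (p2 : hom P Y) : Prop :=
  f ∘ p1 = g ∘ p2 /\
  forall (T : C) (a : hom T X) (b : hom T Y), f ∘ a = g ∘ b ->
    exists! k : hom T P, p1 ∘ k = a /\ p2 ∘ k = b.

Definition finite_type (T : Type) : Prop := exists s : list T, forall x : T, In x s.

Definition finite_category (J : category) : Prop :=
  finite_type J /\ forall i j : J, finite_type (hom i j).

Definition is_cone (J C : category) (D : functor J C) (L : C)
    (l : forall j : J, hom L (D j)) : Prop :=
  forall (i j : J) (u : hom i j), fmap D u ∘ l i = l j.

Definition is_limit (J C : category) (D : functor J C) (L : C)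
    (l : forall j : J, hom L (D j)) : Prop :=
  is_cone l /\
  forall (T : C) (t : forall j : J, hom T (D j)), is_cone t ->
    exists! k : hom T L, forall j : J, l j ∘ k = t j.

Definition finitely_complete (C : category) : Prop :=
  forall (J : category), finite_category J -> forall D : functor J C,
    exists (L : C) (l : forall j : J, hom L (D j)), is_limit l.

Record regular (C : category) : Prop := Regular {
  regular_finitely_complete : finitely_complete C;
  regular_coequalizer : forall (X Y K : C) (f : hom X Y) (p1 p2 : hom K X),
    is_pullback f f p1 p2 -> exists (Q : C) (e : hom X Q), is_coequalizer p1 p2 e;
  regular_epi_stable : forall (X Y Z P : C) (f : hom X Z) (g : hom Y Z)
    (p1 : hom P X) (p2 : hom P Y),
    is_pullback f g p1 p2 -> regular_epi f -> regular_epi p2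
}.

Definition is_image (C : category) (X Y : C) (f : hom X Y) (Z : C) : Prop :=
  exists (e : hom X Z) (m : hom Z Y), regular_epi e /\ mono m /\ f = m ∘ e.

(* Images are only determined up to isomorphism; an image map is any choice of
   them.  Every morphism of a regular category has one: see [image_exists]. *)
Definition image_map (C : category)
    (im : forall X Y : C, hom X Y -> C) : Prop :=
  forall (X Y : C) (f : hom X Y), is_image f (im X Y f).

Record rank_function (R : category) (r : R -> Z) : Prop := RankFunction {
  rank_lower_bounded : exists m : Z, forall A : R, (m <= r A)%Z;
  rank_mono : forall (A B : R) (i : hom A B), mono i -> (r A <= r B)%Z;
  rank_regular_epi : forall (B D : R) (q : hom B D),
    regular_epi q -> (r B >= r D)%Z;
  rank_pullback : forall (A B C D : R)
    (i : hom A B) (j : hom C D) (e : hom A C) (q : hom B D),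
    mono i -> mono j -> regular_epi e -> regular_epi q -> is_pullback q j i e ->
    (r B - r A >= r D - r C)%Z
}.

Definition ranked_category (R : category) (r : R -> Z) : Prop :=
  regular R /\ rank_function r.

Record persistence_function (C : category)
    (p : forall X Y : C, hom X Y -> Z) : Prop := PersistenceFunction {
  persistence_lower_bounded :
    exists m : Z, forall (X Y : C) (f : hom X Y), (m <= p X Y f)%Z;
  persistence_monotone : forall (u1 u2 v1 v2 : C)
    (a : hom u1 u2) (b : hom u2 v1) (c : hom v1 v2),
    (p u1 v1 (b ∘ a) <= p u2 v1 b)%Z /\ (p u2 v2 (c ∘ b) <= p u2 v1 b)%Z;
  persistence_difference : forall (u1 u2 v1 v2 : C)
    (a : hom u1 u2) (b : hom u2 v1) (c : hom v1 v2),
    (p u2 v1 b - p u1 v1 (b ∘ a) >= p u2 v2 (c ∘ b) - p u1 v2 (c ∘ b ∘ a))%Z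
}.

Inductive cospan_obj : Set := cospan_l | cospan_r | cospan_tip.

Definition cospan_hom (x y : cospan_obj) : Set :=
  match x, y with
  | cospan_l, cospan_l | cospan_r, cospan_r | _, cospan_tip => unit
  | _, _ => Empty_set
  end.

Definition cospan_id (x : cospan_obj) : cospan_hom x x :=
  match x with cospan_l | cospan_r | cospan_tip => tt end.

Definition cospan_comp (x y z : cospan_obj) :
  cospan_hom y z -> cospan_hom x y -> cospan_hom x z.
Proof.
destruct x, y, z; simpl; intros g f;
  first [exact tt | destruct g; fail | destruct f; fail].
Defined.

Definition cospan : category.
Proof.
apply (@Category cospan_obj cospan_hom cospan_id cospan_comp).
- intros [] []; simpl; intros []; reflexivity.
- intros [] []; simpl; intros []; reflexivity.
- intros [] [] [] []; simpl; intros [] [] []; reflexivity.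
Defined.

Lemma cospan_finite : finite_category cospan.
Proof.
split.
- exists (cospan_l :: cospan_r :: cospan_tip :: nil); intros []; simpl; tauto.
- intros [] []; simpl;
    first [exists (tt :: nil); intros []; simpl; tauto
          | exists nil; intros []].
Qed.

Definition cospan_diagram (C : category) (X Y Z : C)
  (f : hom X Z) (g : hom Y Z) : functor cospan C.
Proof.
pose (o := fun x : cospan =>
  match x return C with cospan_l => X | cospan_r => Y | cospan_tip => Z end).
pose (m := fun x y : cospan =>
  match x, y return cospan_hom x y -> hom (o x) (o y) with
  | cospan_l, cospan_l => fun _ => idm X
  | cospan_r, cospan_r => fun _ => idm Y
  | cospan_tip, cospan_tip => fun _ => idm Z
  | cospan_l, cospan_tip => fun _ => f
  | cospan_r, cospan_tip => fun _ => g
  | cospan_l, cospan_r | cospan_r, cospan_l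
  | cospan_tip, cospan_l | cospan_tip, cospan_r => fun u => match u with end
  end).
apply (@Functor cospan C o m).
- intros []; reflexivity.
- intros [] [] []; simpl; intros [] []; simpl;
    rewrite ?comp_id_l, ?comp_id_r; reflexivity.
Defined.

Lemma pullback_exists (C : category) : finitely_complete C ->
  forall (X Y Z : C) (f : hom X Z) (g : hom Y Z),
  exists (P : C) (p1 : hom P X) (p2 : hom P Y), is_pullback f g p1 p2.
Proof.
intros HC X Y Z f g.
destruct (HC _ cospan_finite (cospan_diagram f g)) as [P [l [Hl Hu]]].
exists P, (l cospan_l), (l cospan_r).
pose proof (Hl cospan_l cospan_tip tt) as H1.
pose proof (Hl cospan_r cospan_tip tt) as H2.
simpl in H1, H2.
split; [congruence|].
intros T a b Hab.
pose (t := fun j : cospan =>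
  match j return hom T (cospan_diagram f g j) with
  | cospan_l => a | cospan_r => b | cospan_tip => f ∘ a end).
destruct (Hu T t) as [k [Hk Huk]].
- intros [] []; simpl; intros []; simpl; rewrite ?comp_id_l; auto.
- exists k; split.
  + split; [apply (Hk cospan_l) | apply (Hk cospan_r)].
  + intros k' [Ha Hb]; apply Huk; intros []; simpl; auto.
    rewrite <- H1, <- comp_assoc, Ha; reflexivity.
Qed.

Lemma regular_epi_epi (C : category) (X Q : C) (e : hom X Q) : regular_epi e ->
  forall (T : C) (a b : hom Q T), a ∘ e = b ∘ e -> a = b.
Proof.
intros [A [f [g [He Hu]]]] T a b Hab.
destruct (Hu T (a ∘ e)) as [k [_ Hk]].
- rewrite <- !comp_assoc, He; reflexivity.
- rewrite <- (Hk a eq_refl); apply Hk; auto.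
Qed.

Lemma image_exists (C : category) : regular C ->
  forall (X Y : C) (f : hom X Y), exists Z : C, is_image f Z.
Proof.
intros HC X Y f.
pose proof (regular_finitely_complete HC) as Hfc.
destruct (pullback_exists Hfc f f) as [K [p1 [p2 Hpb]]].
destruct (regular_coequalizer HC Hpb) as [Q [e He]].
assert (Hre : regular_epi e) by (exists K, p1, p2; exact He).
destruct Hpb as [Hp Hpu].
destruct He as [Hee Heu].
destruct (Heu Y f Hp) as [m [Hm _]].
exists Q, e, m; split; [exact Hre|split; [|symmetry; exact Hm]].
intros T a b Hab.
destruct (pullback_exists Hfc e a) as [P1 [x1 [e1 Hpb1]]].
pose proof (regular_epi_stable HC Hpb1 Hre) as He1.
destruct (pullback_exists Hfc e (b ∘ e1)) as [P2 [x2 [e2 Hpb2]]].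
pose proof (regular_epi_stable HC Hpb2 Hre) as He2.
destruct Hpb1 as [E1 _], Hpb2 as [E2 _].
apply (regular_epi_epi He1), (regular_epi_epi He2).
destruct (Hpu P2 (x1 ∘ e2) x2) as [k [[K1 K2] _]].
- rewrite <- Hm, <- (comp_assoc m e x2), E2, !comp_assoc.
  rewrite <- Hab, <- (comp_assoc m e x1), E1, !comp_assoc; reflexivity.
- rewrite <- E2, <- K2, <- E1, <- comp_assoc, <- K1, !comp_assoc, Hee; reflexivity.
Qed.

(* Main.v *)
Require Import Defs.
From Stdlib Require Import ZArith Lia.

(** For composable [a], [b], [c] the images of [b ∘ a], [b], [c ∘ b ∘ a] and
    [c ∘ b] form a commutative square whose horizontal maps [i], [j] are monic
    and whose vertical maps [e], [q] are regular epimorphisms: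
<<
      im (b ∘ a)  --i-->  im b
          |                |
          e                q
          v                v
    im (c ∘ b ∘ a) --j--> im (c ∘ b)
>>
    Monotonicity of the rank along [i] and [q] gives the first axiom.  The square
    need not be a pullback, but [im (b ∘ a)] embeds into the pullback [P] of [q]
    and [j], so replacing [im (b ∘ a)] by [P] only decreases
    [r (im b) - r (im (b ∘ a))]. *)

(** As [m] is monic, [u] equalizes the pair whose coequalizer is [e], which yields [d]; cancelling
    the epimorphism [e] gives the other triangle. *)
Lemma regular_epi_mono_diagonal {C : category} {X Q Y Z : C} {e : hom X Q}
    {m : hom Y Z} {u : hom X Y} {v : hom Q Z} :
  regular_epi e -> mono m -> m ∘ u = v ∘ e ->
  exists d : hom Q Y, d ∘ e = u /\ m ∘ d = v.
Proof.
intros He Hm Huv.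
pose proof (regular_epi_epi He) as Hepi.
destruct He as [A [f [g [Hfg Hu]]]].
destruct (Hu Y u) as [d [Hd _]].
- apply Hm; rewrite !comp_assoc, Huv, <- !comp_assoc, Hfg; reflexivity.
- exists d; split; [exact Hd|].
  apply Hepi; rewrite <- comp_assoc, Hd; exact Huv.
Qed.

Lemma mono_cancel {C : category} {X Y Z : C} {f : hom X Y} {g : hom Y Z} :
  mono (g ∘ f) -> mono f.
Proof.
intros Hgf T a b Hab; apply Hgf.
rewrite <- !comp_assoc, Hab; reflexivity.
Qed.

Lemma regular_epi_iso_comp {C : category} {X Y Z : C} {e : hom X Y}
    {m : hom Y Z} {s : hom Z Y} :
  regular_epi e -> m ∘ s = idm Z -> s ∘ m = idm Y -> regular_epi (m ∘ e).
Proof.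
intros [A [f [g [Hfg Hu]]]] Hms Hsm.
exists A, f, g; split.
- rewrite <- !comp_assoc, Hfg; reflexivity.
- intros T h Hh; destruct (Hu T h Hh) as [k [Hk Huk]].
  exists (k ∘ s); split.
  + rewrite <- comp_assoc, (comp_assoc s m e), Hsm, comp_id_l; exact Hk.
  + intros k' Hk'.
    rewrite (Huk (k' ∘ m)) by (rewrite <- comp_assoc; exact Hk').
    rewrite <- comp_assoc, Hms, comp_id_r; reflexivity.
Qed.

(** Lifting [q ∘ p] against the monic part [m] of [q] gives a section of [m]; a monomorphism with a
    section is invertible, so [q] is a regular epimorphism followed by an isomorphism. *)
Lemma regular_epi_cancel {C : category} {X Y Z : C} {p : hom X Y} {q : hom Y Z} :
  regular C -> regular_epi (q ∘ p) -> regular_epi q.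
Proof.
intros HC Hqp.
destruct (image_exists HC q) as [I [e [m [He [Hm ->]]]]].
destruct (regular_epi_mono_diagonal (u := e ∘ p) (v := idm Z) Hqp Hm)
  as [s [_ Hms]].
- rewrite comp_id_l, comp_assoc; reflexivity.
- apply (regular_epi_iso_comp He Hms).
  apply Hm; rewrite comp_assoc, Hms, comp_id_l, comp_id_r; reflexivity.
Qed.

Lemma mono_pullback {C : category} {X Y Z P : C} {f : hom X Z} {g : hom Y Z}
    {p1 : hom P X} {p2 : hom P Y} :
  is_pullback f g p1 p2 -> mono g -> mono p1.
Proof.
intros [Hp Hu] Hg T a b Hab.
destruct (Hu T (p1 ∘ a) (p2 ∘ a)) as [k [_ Hk]].
- rewrite !comp_assoc, Hp; reflexivity.
- rewrite <- (Hk a) by auto; apply Hk; split; [auto|].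
  apply Hg; rewrite !comp_assoc, <- Hp, <- !comp_assoc, Hab; reflexivity.
Qed.

(** Source of the horizontal maps of the square: [e'] is lifted against [m]. *)
Lemma image_precomp {C : category} {W X Y I J : C} {a : hom W X}
    {e : hom X I} {m : hom I Y} {e' : hom W J} {m' : hom J Y} :
  mono m -> regular_epi e' -> mono m' -> m ∘ e ∘ a = m' ∘ e' ->
  exists i : hom J I, mono i /\ m ∘ i = m'.
Proof.
intros Hm He' Hm' H; rewrite <- comp_assoc in H.
destruct (regular_epi_mono_diagonal He' Hm H) as [i [_ Hi]].
exists i; split; [|exact Hi].
apply (mono_cancel (g := m)); rewrite Hi; exact Hm'.
Qed.

(** Source of the vertical maps: [e] is lifted against [m'], and the lift [q] inherits regularity
    from [q ∘ e = e']. *)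
Lemma image_postcomp {C : category} {X Y Z I J : C} {c : hom Y Z}
    {e : hom X I} {m : hom I Y} {e' : hom X J} {m' : hom J Z} :
  regular C -> regular_epi e -> regular_epi e' -> mono m' ->
  c ∘ (m ∘ e) = m' ∘ e' ->
  exists q : hom I J, regular_epi q /\ m' ∘ q = c ∘ m.
Proof.
intros HC He He' Hm' H; rewrite comp_assoc in H.
destruct (regular_epi_mono_diagonal He Hm' (eq_sym H)) as [q [Hqe Hq]].
exists q; split; [|exact Hq].
apply (regular_epi_cancel (p := e) HC); rewrite Hqe; exact He'.
Qed.

Lemma rank_square {R : category} {r : R -> Z} {A B C D : R}
    {i : hom A B} {j : hom C D} {e : hom A C} {q : hom B D} :
  ranked_category r -> mono i -> mono j -> regular_epi q -> q ∘ i = j ∘ e ->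
  (r B - r A >= r D - r C)%Z.
Proof.
intros [HR Hr] Hi Hj Hq H.
destruct (pullback_exists (regular_finitely_complete HR) q j)
  as [P [p1 [p2 Hpb]]].
pose proof (mono_pullback Hpb Hj) as Hp1.
pose proof (regular_epi_stable HR Hpb Hq) as Hp2.
pose proof (rank_pullback Hr Hp1 Hj Hp2 Hq Hpb) as HP.
destruct Hpb as [_ Hu]; destruct (Hu A i e H) as [k [[Hk _] _]].
(* The comparison map [k] into the pullback is monic because [p1 ∘ k = i] is, whence
   [r A <= r P]. *)
assert (Hkm : mono k) by (apply (mono_cancel (g := p1)); rewrite Hk; exact Hi).
pose proof (rank_mono Hr Hkm); lia.
Qed.

Theorem proposition9 (R : category) (r : R -> Z) (im : forall X Y : R, hom X Y -> R)
    (C : category) (F : functor C R) :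
  ranked_category r -> image_map im ->
  persistence_function
    (fun (X Y : C) (f : hom X Y) => r (im (F X) (F Y) (fmap F f))).
Proof.
intros HRr Him.
pose proof HRr as [HR Hr].
split.
- destruct (rank_lower_bounded Hr) as [m Hm]; exists m; auto.
- intros u1 u2 v1 v2 a b c.
  destruct (Him _ _ (fmap F b)) as [e [m [He [Hm H]]]].
  split.
  + destruct (Him _ _ (fmap F (b ∘ a))) as [e' [m' [He' [Hm' H']]]].
    (* Only the left side may change: the types of [e'] and [m'] mention the same composite through
       [im]. *)
    rewrite fmap_comp, H in H' at 1.
    destruct (image_precomp Hm He' Hm' H') as [i [Hi _]].
    exact (rank_mono Hr Hi).
  + destruct (Him _ _ (fmap F (c ∘ b))) as [e' [m' [He' [Hm' H']]]].
    rewrite fmap_comp, H in H' at 1.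
    destruct (image_postcomp HR He He' Hm' H') as [q [Hq _]].
    apply Z.ge_le, (rank_regular_epi Hr Hq).
- intros u1 u2 v1 v2 a b c.
  rewrite !fmap_comp.
  set (fa := fmap F a); set (fb := fmap F b); set (fc := fmap F c).
  destruct (Him _ _ fb) as [eB [mB [HeB [HmB HB]]]].
  destruct (Him _ _ (fb ∘ fa)) as [eA [mA [HeA [HmA HA]]]].
  destruct (Him _ _ (fc ∘ fb)) as [eD [mD [HeD [HmD HD]]]].
  destruct (Him _ _ (fc ∘ fb ∘ fa)) as [eC [mC [HeC [HmC HC]]]].
  assert (H1 : mB ∘ eB ∘ fa = mA ∘ eA) by congruence.
  assert (H2 : mD ∘ eD ∘ fa = mC ∘ eC) by congruence.
  assert (H3 : fc ∘ (mB ∘ eB) = mD ∘ eD) by congruence.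
  assert (H4 : fc ∘ (mA ∘ eA) = mC ∘ eC)
    by (rewrite <- HA, <- HC; apply comp_assoc).
  destruct (image_precomp HmB HeA HmA H1) as [i [Hi Ei]].
  destruct (image_precomp HmD HeC HmC H2) as [j [Hj Ej]].
  destruct (image_postcomp HR HeB HeD HmD H3) as [q [Hq Eq]].
  destruct (image_postcomp HR HeA HeC HmC H4) as [e [_ Ee]].
  apply (rank_square (i := i) (j := j) (e := e) (q := q) HRr Hi Hj Hq).
  (* The square commutes because both paths, followed by the monomorphism [mD], equal [fc ∘ mA]. *)
  apply HmD.
  rewrite !comp_assoc, Eq, Ej, Ee, <- comp_assoc, Ei; reflexivity.
Qed.
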